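(* For every integer $n\geq 1$, the representation number of the crown graph $H_{n,n}$ is at least $\lceil n/2 \rceil$.
   Context: The crown graph $H_{n,n}$ is the simple graph with vertex set $\{1,\ldots,n,1',\ldots,n'\}$ ($2n$ distinct vertices) and edge set $\{ij' : 1\le i,j\le n,\ i\neq j\}$; that is, the complete bipartite graph $K_{n,n}$ with a perfect matching removed. Two distinct letters $x,y$ alternate in a word $w$ if, after deleting all letters other than $x$ and $y$ from $w$, no two consecutive letters of the resulting word are equal. For a positive integer $k$, a word $w$ over the alphabet $V$ $k$-represents a simple graph $G=(V,E)$ if each letter of $V$ occurs exactly $k$ times in $w$ and, for all distinct $x,y\in V$, the letters $x$ and $y$ alternate in $w$ if and only if $xy\in E$. A graph is $k$-word-representable if some word $k$-represents it. A graph is word-representable if and only if it is $k$-word-representable for some $k\ge 1$; the representation number of a word-representable graph is the minimum such $k$. It is known that every crown graph $H_{n,n}$ is word-representable, so its representation number is defined. *)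

(* Defs.v *)
From mathcomp Require Import all_boot.

Set Implicit Arguments.
Unset Strict Implicit.
Unset Printing Implicit Defensive.

Record sgraph := SGraph {
  vertex :> finType;
  edge : rel vertex;
  edge_sym : symmetric edge;
  edge_irrefl : irreflexive edge }.

Definition alternate (T : eqType) (x y : T) (w : seq T) : bool :=
  sorted (fun a b => a != b) [seq z <- w | z \in pred2 x y].

Definition k_represents (G : sgraph) (k : nat) (w : seq G) : bool :=
  [forall x : G, count_mem x w == k] &&
  [forall x : G, forall y : G,
     (x != y) ==> (alternate x y w == edge x y)].

Definition k_word_representable (G : sgraph) (k : nat) : Prop :=
  exists w : seq G, k_represents k w.

(* Word-representability through uniform words: a graph is represented by some
   word iff it is k-represented by some word for some k >= 1. *)
Definition word_representable (G : sgraph) : Prop :=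
  exists2 k, 0 < k & k_word_representable G k.

Lemma k_represents_size (G : sgraph) k (w : seq G) :
  k_represents k w -> size w = k * #|G|.
Proof.
case/andP=> /forallP cw _.
rewrite -(sum1_size w) (partition_big id predT) //=.
rewrite (eq_bigr (fun=> k)) => [|x _]; first by rewrite sum_nat_const mulnC.
by rewrite sum1_count; apply/eqP/cw.
Qed.

(* A word k-representing G has length k * #|G|, so only finitely many words
   need to be tried. *)
Lemma k_word_representableP (G : sgraph) k :
  reflect (k_word_representable G k)
          [exists w : (k * #|G|).-tuple G, k_represents k w].
Proof.
apply: (iffP existsP) => [[w rw]|[w rw]]; first by exists w.
have sw : size w == k * #|G| by apply/eqP/k_represents_size.
by exists (Tuple sw).
Qed.

Lemma word_representable_exb (G : sgraph) : word_representable G ->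
  exists k, (0 < k) && [exists w : (k * #|G|).-tuple G, k_represents k w].
Proof.
by case=> k k0 rk; exists k; rewrite k0; apply/k_word_representableP.
Qed.

Definition representation_number (G : sgraph) (h : word_representable G) : nat :=
  ex_minn (word_representable_exb h).

Lemma representation_numberP (G : sgraph) (h : word_representable G) :
  [/\ 0 < representation_number h,
      k_word_representable G (representation_number h) &
      forall k, 0 < k -> k_word_representable G k ->
        representation_number h <= k].
Proof.
rewrite /representation_number; case: ex_minnP => m /andP[m0 rm] minm.
split=> //; first exact/k_word_representableP.
by move=> k k0 rk; apply: minm; rewrite k0; apply/k_word_representableP.
Qed.

(* The vertices are inl i, standing for i, and inr i, standing for i'. *)
Definition crown_edge n : rel ('I_n + 'I_n) := fun u v =>
  match u, v with
  | inl i, inr j | inr j, inl i => i != j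
  | _, _ => false
  end.

Lemma crown_edge_sym n : symmetric (@crown_edge n).
Proof. by case=> i [] j. Qed.

Lemma crown_edge_irrefl n : irreflexive (@crown_edge n).
Proof. by case. Qed.

Definition crown n : sgraph := SGraph (@crown_edge_sym n) (@crown_edge_irrefl n).

(* The permutation of the vertices listing the j and then the j', with m and m'
   moved to the middle in the order m' m. For n >= 2 the concatenation of these
   n permutations n-represents the crown graph. *)
Definition crown_block n (m : 'I_n) : seq (crown n) :=
  [seq inl j | j <- enum 'I_n & j != m] ++ [:: inr m; inl m] ++
  [seq inr j | j <- enum 'I_n & j != m].

Definition crown_word n : seq (crown n) :=
  flatten [seq crown_block m | m <- enum 'I_n].

Definition block_restr n (x y : crown n) (m : 'I_n) : seq (crown n) :=
  [seq z <- crown_block m | z \in pred2 x y].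

Lemma mem_crown_block n (m : 'I_n) (x : crown n) : x \in crown_block m.
Proof.
rewrite /crown_block !mem_cat !inE.
have inlI : injective (@inl 'I_n 'I_n) by move=> ? ? [].
have inrI : injective (@inr 'I_n 'I_n) by move=> ? ? [].
case: x => i; case: (eqVneq i m) => [->|im]; rewrite ?eqxx ?orbT //.
  by rewrite (mem_map inlI) mem_filter im mem_enum.
by rewrite (mem_map inrI) mem_filter im mem_enum ?orbT.
Qed.

Lemma crown_block_uniq n (m : 'I_n) : uniq (crown_block m).
Proof.
have inlI : injective (@inl 'I_n 'I_n) by move=> ? ? [].
have inrI : injective (@inr 'I_n 'I_n) by move=> ? ? [].
have mN : m \notin [seq j <- enum 'I_n | j != m] by rewrite mem_filter eqxx.
rewrite /crown_block !cat_uniq (map_inj_uniq inlI) (map_inj_uniq inrI).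
rewrite filter_uniq ?enum_uniq //=.
rewrite (mem_map inlI).
rewrite (negPf mN) andbT; apply/andP; split.
  rewrite negb_or; apply/andP; split; first by apply/mapP=> -[].
  by apply/hasPn=> _ /mapP[j _ ->]; apply/mapP=> -[].
apply/hasPn=> _ /mapP[j jm ->]; rewrite !inE orbF.
by apply: contraL jm => /eqP[->].
Qed.

Lemma block_restr_cases n (x y : crown n) m : x != y ->
  block_restr x y m = [:: x; y] \/ block_restr x y m = [:: y; x].
Proof.
move=> xy.
have ur : uniq (block_restr x y m) by rewrite filter_uniq ?crown_block_uniq.
have pr : perm_eq (block_restr x y m) [:: x; y].
  apply: uniq_perm => //; first by rewrite /= inE xy.
  by move=> z; rewrite mem_filter mem_crown_block andbT !inE.
move: ur (perm_size pr) (perm_mem pr).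
case: (block_restr x y m) => [|a [|b []]] //=.
rewrite inE andbT => ab _ ma.
have := ma a; have := ma b; rewrite !inE !eqxx ?orbT /=.
move=> /esym/orP bxy /esym/orP axy.
by move: ab; case: axy => /eqP->; case: bxy => /eqP->; rewrite ?eqxx //;
  [left|right].
Qed.

Lemma alternate_crown_word n (x y : crown n) : alternate x y (crown_word n) =
  sorted (fun a b => a != b)
    (flatten [seq block_restr x y m | m <- enum 'I_n]).
Proof. by rewrite /alternate /crown_word filter_flatten -map_comp. Qed.

Lemma alternate_crown_word_const n (x y : crown n) : x != y ->
  (forall m, block_restr x y m = [:: x; y]) -> alternate x y (crown_word n).
Proof.
move=> xy rE; rewrite alternate_crown_word.
case: (enum _) => //= m s; rewrite rE /= xy /=.
by elim: s => //= {}m s IH; rewrite rE /= eq_sym xy.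
Qed.

Lemma alternate_blocks_eq n (x y : crown n) m s : x != y ->
  sorted (fun a b => a != b)
    (flatten [seq block_restr x y j | j <- m :: s]) ->
  {in s, forall j, block_restr x y j = block_restr x y m}.
Proof.
move=> xy; elim: s m => [|k s IH] m // sw.
have [skw km] : sorted (fun a b => a != b)
    (flatten [seq block_restr x y j | j <- k :: s])
    /\ block_restr x y k = block_restr x y m.
  move: sw => /=; case: (block_restr_cases m xy) => ->;
  case: (block_restr_cases k xy) => -> /=;
  by rewrite ?eqxx ?andbF //= => /and3P[].
move=> j; rewrite inE => /predU1P[->//|js].
by rewrite (IH k).
Qed.

Lemma nalternate_crown_word n (x y : crown n) m1 m2 : x != y ->
  block_restr x y m1 <> block_restr x y m2 ->
  alternate x y (crown_word n) = false.
Proof.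
move=> xy ne; apply/negP; rewrite alternate_crown_word.
move: (mem_enum 'I_n m1) (mem_enum 'I_n m2).
case: (enum 'I_n) => // m s; rewrite !inE => m1s m2s /(alternate_blocks_eq xy) E.
apply: ne; move: m1s m2s.
by case/predU1P=> [->|/E->]; case/predU1P=> [->|/E->].
Qed.

Lemma filter_side n (U : eqType) (f : 'I_n -> U) (p : pred U) m i :
  (forall j, p (f j) = (j == i)) ->
  [seq z <- [seq f j | j <- enum 'I_n & j != m] | p z] =
  if i == m then [::] else [:: f i].
Proof.
move=> pE; rewrite filter_map -filter_predI.
rewrite (@eq_filter _ _ (fun j => (i != m) && (j == i))); last first.
  move=> j /=; rewrite pE; case: (eqVneq j i) => [->|] //=.
  by rewrite andbT.
  by rewrite andbF.
case: (eqVneq i m) => _ /=; first by rewrite filter_pred0.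
by rewrite filter_pred1_uniq ?enum_uniq ?mem_enum.
Qed.

Lemma filter_side0 n (U : eqType) (f : 'I_n -> U) (p : pred U) m :
  (forall j, p (f j) = false) ->
  [seq z <- [seq f j | j <- enum 'I_n & j != m] | p z] = [::].
Proof.
move=> pE; rewrite filter_map -filter_predI.
by rewrite (@eq_filter _ _ pred0) ?filter_pred0 // => j /=; rewrite pE.
Qed.

Lemma inl_eqE n (i j : 'I_n) : ((inl i : crown n) == inl j) = (i == j).
Proof. by []. Qed.
Lemma inr_eqE n (i j : 'I_n) : ((inr i : crown n) == inr j) = (i == j).
Proof. by []. Qed.

Lemma block_restr_lr n (i j m : 'I_n) :
  block_restr (inl i : crown n) (inr j) m =
  if (i == m) && (j == m) then [:: inr j; inl i] else [:: inl i; inr j].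
Proof.
rewrite /block_restr /crown_block !filter_cat.
rewrite (@filter_side n (crown n) inl _ _ i); last first.
  by move=> k; rewrite !inE orbF.
rewrite (@filter_side n (crown n) inr _ _ j) //=.
rewrite !inE /= orbF inr_eqE inl_eqE !(eq_sym m).
by case: (eqVneq i m) => [->|]; case: (eqVneq j m) => [->|].
Qed.

Lemma block_restr_ll n (i j : 'I_n) : i != j ->
  block_restr (inl i : crown n) (inl j) i = [:: inl j; inl i].
Proof.
move=> ij; rewrite /block_restr /crown_block !filter_cat.
rewrite [X in _ ++ _ ++ X]filter_side0 // filter_map -filter_predI.
rewrite (@eq_filter _ _ (pred1 j)); last first.
  move=> k /=; rewrite !inE !inl_eqE.
  by case: (eqVneq k j) => [->|]; rewrite ?orbF ?orbT ?andbN 1?eq_sym.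
rewrite filter_pred1_uniq ?enum_uniq ?mem_enum //=.
by rewrite !inE inl_eqE eqxx.
Qed.

Lemma block_restr_rr n (i j : 'I_n) : i != j ->
  block_restr (inr i : crown n) (inr j) i = [:: inr i; inr j].
Proof.
move=> ij; rewrite /block_restr /crown_block !filter_cat.
rewrite [X in X ++ _]filter_side0 // filter_map -filter_predI.
rewrite (@eq_filter _ _ (pred1 j)); last first.
  move=> k /=; rewrite !inE !inr_eqE.
  by case: (eqVneq k j) => [->|]; rewrite ?orbF ?orbT ?andbN 1?eq_sym.
rewrite filter_pred1_uniq ?enum_uniq ?mem_enum //=.
by rewrite !inE inr_eqE eqxx.
Qed.

Lemma block_restrC n (x y : crown n) m : block_restr x y m = block_restr y x m.
Proof. by apply: eq_filter => z; rewrite !inE orbC. Qed.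

Lemma alternateC (T : eqType) (x y : T) w : alternate x y w = alternate y x w.
Proof.
rewrite /alternate; congr sorted.
by apply: eq_filter => z; rewrite !inE orbC.
Qed.

Lemma crown_word_represents n : 1 < n -> @k_represents (crown n) n (crown_word n).
Proof.
move=> n1; apply/andP; split.
  apply/forallP=> x; rewrite count_flatten -map_comp.
  rewrite (eq_map (_ : _ =1 fun=> 1)); last first.
    by move=> m /=; rewrite count_uniq_mem ?crown_block_uniq ?mem_crown_block.
  by rewrite sumnE big_map sum1_size size_enum_ord.
have lr (i j : 'I_n) :
    alternate (inl i : crown n) (inr j) (crown_word n) = (i != j).
  case: (eqVneq i j) => [<-|ij] /=.
    have [m im] : exists m, i != m.
      exists (if i == Ordinal n1 then Ordinal (ltnW n1) else Ordinal n1).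
      by case: ifP => [/eqP->|->].
    apply: (@nalternate_crown_word _ _ _ i m) => //.
    by rewrite !block_restr_lr eqxx (negPf im).
  apply: alternate_crown_word_const => // m; rewrite block_restr_lr.
  by case: eqP => [<-|]; rewrite //= eq_sym (negPf ij).
apply/forallP=> x; apply/forallP=> y; apply/implyP.
case: x => i; case: y => j xy /=; apply/eqP.
- have ij : i != j by rewrite inl_eqE in xy.
  apply: (@nalternate_crown_word _ _ _ i j) => //.
  rewrite block_restr_ll // block_restrC block_restr_ll 1?eq_sym // => -[/esym/eqP].
  by rewrite (negPf ij).
- exact: lr.
- by rewrite alternateC lr eq_sym.
have ij : i != j by rewrite inr_eqE in xy.
apply: (@nalternate_crown_word _ _ _ i j) => //.
rewrite block_restr_rr // block_restrC block_restr_rr 1?eq_sym // => -[/eqP].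
by rewrite (negPf ij).
Qed.

Lemma crown_word_representable n : 0 < n -> word_representable (crown n).
Proof.
case: n => // -[|n] _; last first.
  by exists n.+2 => //; exists (crown_word n.+2); apply: crown_word_represents.
exists 2 => //; exists [:: inl ord0; inl ord0; inr ord0; inr ord0].
by apply/andP; split; apply/forallP=> -[] i; rewrite ?(ord1 i) //;
  apply/forallP=> -[] j; rewrite ?(ord1 j).
Qed.

(* Main.v *)
(** Let [c_x t] be the number of occurrences of [x] among the first [t] letters.
    Distinct [x] and [y] alternate iff, for some offset [d], the difference
    [c_x - c_y + d] only takes the values 0 and 1.  As [i1] and [i2] do not
    alternate, the offsets of the edges of each 4-cycle [i1 j1' i2 j2'] cancel,
    so for n >= 4 the offset of every edge [i j'] is [a i - b j]; that is, the
    levels [u i = c_i + a i] and [v j = c_j' + b j] satisfy [0 <= u i - v j <= 1]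
    for [i != j].  At some time [u i - v i] is outside of {0, 1}.  Then, for an
    integer [m], either [u i = m + 1], [v i = m - 1] and all other levels are [m],
    or [u i = m], [v i = m + 1], [u j = m + 1] and [v j = m] for [j != i].
    Levels are nondecreasing and grow by at most [k], so two indices with the
    same alternative have distinct [m] modulo [k], whence n <= 2k. *)

Require Import Defs.
From mathcomp Require Import all_boot all_order all_algebra zify.

Set Implicit Arguments.
Unset Strict Implicit.
Unset Printing Implicit Defensive.

(** The [y] heading the path stands for a letter just read, so [x] is due next. Once [x] is read the
    two swap roles, hence the induction generalizes both. *)
Lemma path_filter_pred2P (T : eqType) (x y : T) w : x != y ->
  path (fun a b => a != b) y [seq z <- w | z \in pred2 x y] <->
  (forall t, count_mem y (take t w) <= count_mem x (take t w)
             <= (count_mem y (take t w)).+1).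
Proof.
elim: w x y => [|z w IH] x y xy //=.
rewrite !inE; case: (eqVneq z x) => [->|zx] /=.
  rewrite eq_sym xy /=.
  rewrite (eq_filter (a2 := mem (pred2 y x))); last first.
    by move=> a; rewrite !inE orbC.
  rewrite IH 1?eq_sym //; split=> H t.
    by case: t => //= t; rewrite eqxx (negPf xy); move: (H t); lia.
  by move: (H t.+1); rewrite /= eqxx (negPf xy); lia.
case: (eqVneq z y) => [->|zy] /=.
  rewrite eqxx; split=> // /(_ 1).
  by rewrite /= take0 eqxx eq_sym (negPf xy).
rewrite IH //; split=> H t; last by move: (H t.+1); rewrite /= (negPf zx) (negPf zy).
by case: t => //= t; rewrite (negPf zx) (negPf zy); apply: H.
Qed.

Lemma alternate_path (T : eqType) (x y : T) w : x != y ->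
  alternate x y w =
  path (fun a b => a != b) y [seq z <- w | z \in pred2 x y] ||
  path (fun a b => a != b) x [seq z <- w | z \in pred2 x y].
Proof.
move=> xy; rewrite /alternate.
have: all (mem (pred2 x y)) [seq z <- w | z \in pred2 x y] by apply: filter_all.
case: [seq _ <- _ | _] => //= z s /andP[]; rewrite !inE => /orP[]/eqP-> _.
  by rewrite eqxx orbF eq_sym xy.
by rewrite eqxx xy.
Qed.

Lemma alternateP (T : eqType) (x y : T) w : x != y ->
  alternate x y w <->
  exists d : int, forall t,
    (0 <= (count_mem x (take t w))%:Z - (count_mem y (take t w))%:Z + d <= 1)%R.
Proof.
move=> xy; have yx : y != x by rewrite eq_sym.
have E : [seq z <- w | z \in pred2 x y] = [seq z <- w | z \in pred2 y x].
  by apply: eq_filter => z; rewrite !inE orbC.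
rewrite alternate_path //; split.
  case/orP; last rewrite E.
    by move=> /(path_filter_pred2P _ xy) H; exists 0%R => t; have := H t; lia.
  by move=> /(path_filter_pred2P _ yx) H; exists 1%R => t; have := H t; lia.
(* The empty prefix leaves only the offsets 0 and 1, one for each letter that may come first. *)
case=> d H; have := H 0; rewrite take0 /= => d01.
have [d0|d1] : d = 0%R \/ d = 1%R by lia.
  by apply/orP; left; apply/(path_filter_pred2P _ xy) => t; have := H t; lia.
by apply/orP; right; rewrite E; apply/(path_filter_pred2P _ yx) => t; have := H t; lia.
Qed.

(** Prefixes longer than [w] equal [w], so a failing one can be sought among finitely many
    lengths. *)
Lemma nalternateP (T : eqType) (x y : T) w (d : int) : x != y ->
  ~~ alternate x y w ->
  exists t, ~~ (0 <= (count_mem x (take t w))%:Z - (count_mem y (take t w))%:Z + d <= 1)%R.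
Proof.
move=> xy nalt.
set P := fun t => (0 <= (count_mem x (take t w))%:Z - (count_mem y (take t w))%:Z + d <= 1)%R.
have [/forallP H|] := boolP [forall t : 'I_(size w).+1, P t]; last first.
  by rewrite negb_forall => /existsP[t Pt]; exists t.
case/negP: nalt; apply/alternateP => //; exists d => t.
have lt : minn t (size w) < (size w).+1 by rewrite ltnS geq_minr.
by have := H (Ordinal lt); rewrite /P /= take_min take_size.
Qed.

Lemma avoid3 n (i1 i2 i3 : 'I_n) : 3 < n ->
  exists j, [/\ i1 != j, i2 != j & i3 != j].
Proof.
move=> n4; have : 0 < #|~: [set i1; i2; i3]|.
  have := cardsC [set i1; i2; i3]; rewrite card_ord.
  have : #|[set i1; i2; i3]| <= 3.
    by rewrite !cardsU !cards1; lia.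
  lia.
by case/card_gt0P=> j; rewrite !inE !negb_or -!andbA !(eq_sym j) => /and3P[]; exists j.
Qed.

(** [a i] is the common value of [d i j - d o j] for a fixed index [o]. Comparing [a i1] with [a i2]
    takes an index avoiding [i1], [i2] and [o], hence [3 < n]. *)
Lemma potentials n (d : 'I_n -> 'I_n -> int) : 3 < n ->
  (forall i1 i2 j1 j2, i1 != j1 -> i2 != j1 -> i1 != j2 -> i2 != j2 ->
     d i1 j1 - d i2 j1 = d i1 j2 - d i2 j2)%R ->
  exists a b : 'I_n -> int, forall i j, i != j -> d i j = (a i - b j)%R.
Proof.
move=> n4 dE; have o : 'I_n by case: n n4 {d dE} => // n _; exact: ord0.
have [a aE] : exists a : 'I_n -> int, forall i j, i != j -> o != j ->
    a i = (d i j - d o j)%R.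
  apply: fin_all_exists (fun i (v : int) => forall j, i != j -> o != j ->
    v = (d i j - d o j)%R) _ => i.
  have [j [ij oj _]] := avoid3 i o o n4.
  by exists (d i j - d o j)%R => l il ol; apply: dE.
have ad i1 i2 j : i1 != j -> i2 != j -> (a i1 - a i2 = d i1 j - d i2 j)%R.
  move=> i1j i2j; have [l [i1l i2l ol]] := avoid3 i1 i2 o n4.
  by rewrite (aE i1 l) // (aE i2 l) // (dE _ _ j l) //; lia.
have [b bE] : exists b : 'I_n -> int, forall j i, i != j ->
    b j = (a i - d i j)%R.
  apply: fin_all_exists (fun j (v : int) => forall i, i != j ->
    v = (a i - d i j)%R) _ => j.
  have [l [jl _ _]] := avoid3 j j j n4; rewrite eq_sym in jl.
  by exists (a l - d l j)%R => i ij; have := ad i l j ij jl; lia.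
by exists a, b => i j ij; rewrite (bE j i ij); lia.
Qed.

Lemma level_bound n k (u v : 'I_n -> nat -> int) : 2 < n -> 0 < k ->
  (forall i t1 t2, t1 <= t2 ->
     (0 <= u i t2 - u i t1 <= k%:Z)%R && (0 <= v i t2 - v i t1 <= k%:Z)%R) ->
  (forall i j t, i != j -> (0 <= u i t - v j t <= 1)%R) ->
  (forall i, exists t, ~~ (0 <= u i t - v i t <= 1)%R) ->
  n <= k.*2.
Proof.
move=> n3 k0 step near /fin_all_exists[tau far].
have third i l : exists j : 'I_n, (j != i) && (j != l).
  have : 0 < #|~: [set i; l]|.
    by have := cardsC [set i; l]; rewrite card_ord cards2; lia.
  by case/card_gt0P=> j; rewrite !inE negb_or; exists j.
(* By [far], [up i] means [u i - v i >= 2] at time [tau i], and its negation means [u i < v i]. *)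
pose up i := (0 <= u i (tau i) - v i (tau i))%R.
pose m i : int := (u i (tau i) - (up i)%:Z)%R.
have upE i j : up i -> j != i -> u i (tau i) = (m i + 1)%R /\
    (v i (tau i) = m i - 1 /\ u j (tau i) = m i /\ v j (tau i) = m i)%R.
  (* A third index [l] closes the chain [v l <= u j <= v i + 1 <= u i - 1 <= v l]; swapping [j] and
     [l] gives the rest. *)
  move=> ui ji; have [l /andP[li lj]] := third i j.
  have jl : j != l by rewrite eq_sym.
  have ij : i != j by rewrite eq_sym.
  have il : i != l by rewrite eq_sym.
  have := far i; have := near _ _ (tau i) ij; have := near _ _ (tau i) ji.
  have := near _ _ (tau i) il; have := near _ _ (tau i) li.
  have := near _ _ (tau i) jl; have := near _ _ (tau i) lj.
  by rewrite /m ui /=; move: ui; rewrite /up; lia.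
have downE i j : ~~ up i -> j != i -> u i (tau i) = m i /\
    (v i (tau i) = m i + 1 /\ u j (tau i) = m i + 1 /\ v j (tau i) = m i)%R.
  (* Here the chain is [u j <= v l + 1 <= u i + 1 <= v i <= u j]. *)
  move=> ui ji; have [l /andP[li lj]] := third i j.
  have jl : j != l by rewrite eq_sym.
  have ij : i != j by rewrite eq_sym.
  have il : i != l by rewrite eq_sym.
  have := far i; have := near _ _ (tau i) ij; have := near _ _ (tau i) ji.
  have := near _ _ (tau i) il; have := near _ _ (tau i) li.
  have := near _ _ (tau i) jl; have := near _ _ (tau i) lj.
  by rewrite /m (negPf ui) /=; move: ui; rewrite /up; lia.
(* If [m] grows by D from the earlier to the later of [tau i] and [tau l], one of [u i], [v i] grows
   by D - 1 and the other by D + 1, so [0 <= D - 1] and [D + 1 <= k]. *)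
have sep i l : i != l -> up i = up l -> (1 <= `|m l - m i| < k%:Z)%R.
  move=> il upil; have li : l != i by rewrite eq_sym.
  have step2 : exists s : bool, forall j,
      (0 <= (u j (tau l) - u j (tau i)) * (if s then -1 else 1) <= k%:Z)%R &&
      (0 <= (v j (tau l) - v j (tau i)) * (if s then -1 else 1) <= k%:Z)%R.
    have [le|/ltnW le] := leqP (tau i) (tau l); [exists false|exists true] => j.
      by have := step j _ _ le; lia.
    by have := step j _ _ le; lia.
  case: step2 => s st; have := st i; have := st l.
  case: (boolP (up i)) => ui; move: (ui); rewrite upil => ul.
    have := upE i l ui li; have := upE l i ul il.
    by case: s {st} => /=; lia.
  have := downE i l ui li; have := downE l i ul il.
  by case: s {st} => /=; lia.
(* The absolute value and the second reduction modulo [k] only give the residue the type ['I_k];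
   [modE] shows that they leave it unchanged. *)
pose f i : bool * 'I_k := (up i, Ordinal (ltn_pmod `|(m i %% k)%Z| k0)).
have kz : (k%:Z != 0)%R by lia.
have modE i : (m i %% k)%Z = (`|(m i %% k)%Z| %% k)%N.
  have := modz_ge0 (m i) kz; have := ltz_mod (m i) kz => lt ge.
  by rewrite modn_small; lia.
have finj : injective f.
  move=> i l [upil ml]; apply/eqP/negPn/negP => il.
  have := sep i l il upil.
  have /dvdzP[q ->] : (k%:Z %| (m l - m i)%R)%Z by rewrite -eqz_mod_dvd (modE i) (modE l) ml.
  have [->|[q1|q1]] : (q = 0 \/ 1 <= q \/ q <= -1)%R by lia.
  - by lia.
  - have : (k%:Z <= q * k%:Z)%R by nia.
    by lia.
  have : (q * k%:Z <= - k%:Z)%R by nia.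
  by lia.
by have := leq_card f finj; rewrite card_prod card_bool !card_ord mul2n.
Qed.

Lemma count_take_step (T : eqType) (p : pred T) s t1 t2 : t1 <= t2 ->
  count p (take t1 s) <= count p (take t2 s) <= count p (take t1 s) + count p s.
Proof.
move=> le.
have E : take t1 s = take t1 (take t2 s) by rewrite -take_min (minn_idPl le).
have := congr1 (count p) (cat_take_drop t1 (take t2 s)); rewrite count_cat -E.
have := congr1 (count p) (cat_take_drop t2 s); rewrite count_cat; lia.
Qed.

Lemma k_represents_crown_bound n k (w : seq (crown n)) : 3 < n -> 0 < k ->
  k_represents k w -> n <= k.*2.
Proof.
move=> n4 k0 /andP[/forallP cw /forallP aw].
pose c x t : int := count_mem x (take t w).
have altE (x y : crown n) : x != y -> alternate x y w = edge x y.
  by move=> xy; have /forallP/(_ y)/implyP/(_ xy)/eqP := aw x.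
have [d dP] : exists d : 'I_n * 'I_n -> int, forall p, p.1 != p.2 -> forall t,
    (0 <= c (inl p.1) t - c (inr p.2) t + d p <= 1)%R.
  apply: fin_all_exists (fun p (v : int) => p.1 != p.2 -> forall t,
    (0 <= c (inl p.1) t - c (inr p.2) t + v <= 1)%R) _ => -[i j] /=.
  (* The offset 0 on the diagonal is a mere placeholder. *)
  have [<-|ij] := eqVneq i j; first by exists 0%R.
  have : alternate (inl i : crown n) (inr j) w by rewrite altE.
  by case/alternateP=> // v vP; exists v.
have [|a [b ab]] := @potentials n (fun i j => d (i, j)) n4.
  move=> i1 i2 j1 j2 i1j1 i2j1 i1j2 i2j2.
  have [->|i12] := eqVneq i1 i2; first by lia.
  (* The difference of the counts of [i1] and [i2] plus either of [e1], [e2] lies in [-1, 1]. If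
     these differ, adding the larger one gives a value in [0, 1], so [i1] and [i2] would
     alternate. *)
  set e1 := (_ - _)%R; set e2 := (_ - _)%R; apply/eqP/negPn/negP => e12.
  have : alternate (inl i1 : crown n) (inl i2) w.
    apply/alternateP=> //; exists (Order.max e1 e2) => t.
    have := dP (i1, j1) i1j1 t; have := dP (i2, j1) i2j1 t.
    have := dP (i1, j2) i1j2 t; have := dP (i2, j2) i2j2 t.
    by move: e12; rewrite /e1 /e2 /c /=; lia.
  by rewrite altE.
apply: (@level_bound _ k (fun i t => c (inl i) t + a i)%R
                         (fun j t => c (inr j) t + b j)%R).
- exact: ltnW.
- exact: k0.
- move=> i t1 t2 le; rewrite /c.
  have := count_take_step (pred1 (inl i : crown n)) w le.
  have := count_take_step (pred1 (inr i : crown n)) w le.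
  by have /eqP-> := cw (inl i); have /eqP-> := cw (inr i); rewrite /=; lia.
- by move=> i j t ij; have := dP (i, j) ij t; rewrite (ab i j ij) /=; lia.
move=> i; have : ~~ alternate (inl i : crown n) (inr i) w by rewrite altE //= eqxx.
case/(nalternateP (a i - b i)%R) => // t tP; exists t; move: tP; rewrite /c /=; lia.
Qed.

Lemma uniq_alternate (T : eqType) (x y : T) w : uniq w -> alternate x y w.
Proof. by move=> uw; apply/pairwise_sorted; rewrite -uniq_pairwise filter_uniq. Qed.

Lemma one_word_representable_complete (G : sgraph) (x y : G) :
  k_word_representable G 1 -> x != y -> edge x y.
Proof.
case=> w /andP[/forallP cw /forallP aw] xy.
have /forallP/(_ y)/implyP/(_ xy)/eqP <- := aw x.
apply/uniq_alternate/count_mem_uniq => z; have /eqP cz := cw z.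
by rewrite cz -has_pred1 has_count cz.
Qed.

Theorem theorem5 (n : nat) (hn : 1 <= n) :
  uphalf n <= representation_number (crown_word_representable hn).
Proof.
have [k0 [w wP] _] := representation_numberP (crown_word_representable hn).
move: (representation_number _) k0 w wP => k k0 w wP.
rewrite leq_uphalf_double.
have [n4|n3] := ltnP 3 n; first exact: k_represents_crown_bound k0 wP.
(* For [n <= 3] the bound can fail only if [k = 1] and [n = 3], and then two unprimed vertices would
   have to be adjacent. *)
have [k2|k1] := ltnP 1 k; first by lia.
have k1E : k = 1 by lia.
have [n2|n3'] := leqP n 2; first by lia.
have /(@one_word_representable_complete (crown n)) :
  k_word_representable (crown n) 1 by exists w; rewrite -k1E.
by move=> /(_ (inl (Ordinal hn)) (inl (Ordinal n3')) isT).
Qed.
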